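(* Let $\alpha>-1$, let $k\ge 1$ be an integer, and let $x_m$ and $x_M$ be the least and the largest zero, respectively, of the Laguerre polynomial $L_k^{(\alpha)}(x)$. Then $$x_m>r^2+3r^{4/3}(s^2-r^2)^{-1/3},$$ $$x_M<s^2-3s^{4/3}(s^2-r^2)^{-1/3}+2,$$ where $r=\sqrt{k+\alpha+1}-\sqrt{k}$ and $s=\sqrt{k+\alpha+1}+\sqrt{k}$.
   Context: For $\alpha>-1$, the Laguerre polynomials $L_k^{(\alpha)}(x)$ (of degree $k$) are the polynomials orthogonal on $[0,\infty)$ with respect to the weight function $x^\alpha e^{-x}$. *)

(* Defs.v *)
From HB Require Import structures.
From mathcomp Require Import all_boot all_order all_algebra.
From mathcomp Require Import all_classical all_reals all_analysis.
Set Implicit Arguments.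
Unset Strict Implicit.
Unset Printing Implicit Defensive.
Import Order.TTheory GRing.Theory Num.Theory.
Import numFieldNormedType.Exports.
Local Open Scope classical_set_scope.
Local Open Scope ring_scope.

(* The junk value of powR at the endpoint x = 0 is irrelevant: {0} is a null
   set. *)
Definition laguerre_weight (R : realType) (alpha x : R) : R :=
  x `^ alpha * expR (- x).

(* L n has degree exactly n, and the L n are pairwise orthogonal on [0, +oo[
   for the Laguerre weight.  For alpha > -1 all the integrals below converge
   absolutely, and these conditions determine each L n up to a nonzero constant
   factor; no normalization is imposed, since zeros do not depend on it. *)
Definition laguerre_polynomials (R : realType) (alpha : R)
    (L : nat -> {poly R}) : Prop :=
  (forall n : nat, size (L n) = n.+1) /\
  (forall m n : nat, m != n ->
     (\int[@lebesgue_measure R]_(x in `[0%R, +oo[)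
        ((L m).[x] * (L n).[x] * laguerre_weight alpha x)%:E)%E = 0%E).

Definition least_zero (R : realType) (p : {poly R}) (x : R) : Prop :=
  root p x /\ forall y, root p y -> x <= y.

Definition largest_zero (R : realType) (p : {poly R}) (x : R) : Prop :=
  root p x /\ forall y, root p y -> y <= x.

(* Main.v *)
Require Import Defs.
From HB Require Import structures.
From mathcomp Require Import all_boot all_order all_algebra.
From mathcomp Require Import all_classical all_reals all_analysis.
From mathcomp Require Import complex polyrcf measurable_realfun ring lra.
Set Implicit Arguments.
Unset Strict Implicit.
Unset Printing Implicit Defensive.
Import Order.TTheory GRing.Theory Num.Theory.
Import numFieldNormedType.Exports.
Local Open Scope classical_set_scope.
Local Open Scope ring_scope.

(** The polynomial [f = L_k] satisfies the Laguerre equation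
    [x f'' + (A - x) f' + k f = 0] with [A = alpha + 1 = s r], and all its zeros
    are real, simple and positive.  For a zero [z] write [f = (x - z) h].  As [h]
    has only real zeros, [h'^2 - h h'' >= 0], and hence

      [f'^2 - f f'' = h^2 + (x - z)^2 (h'^2 - h h'') >= h^2 = f^2 / (x - z)^2].

    At a point where [2 x f' = (x - A) f], a critical point of
    [x^(A/2) e^(-x/2) f(x)], the equation turns [4 x^2 (f'^2 - f f'')] into
    [(4 k x - (x - A)^2) f^2 = (s^2 - x) (x - r^2) f^2], so that there

      [4 x^2 <= (s^2 - x) (x - r^2) (x - z)^2].

    Beyond an extreme zero, on the side away from the other zeros, such a critical
    point exists: [f' / f - (1 - A / x) / 2] runs from one infinity at the zero to
    the opposite sign near [0] or near infinity.

    If [z] is the least zero, then [r^2 < x < z], and with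
    [27 y u^2 <= 4 (y + u)^3] for [y = x - r^2], [u = z - x] the bound gives
    [(z - r^2)^3 >= 27 x^2 / (s^2 - x) > 27 r^4 / (s^2 - r^2)].  If [z] is the
    largest zero, put [y = s^2 - x] and [u = x - z]; then
    [y u^2 >= 4 x^2 / (x - r^2) >= 4 s^4 / (s^2 - r^2) - 4 y], and absorbing [4 y]
    by [u^2 + 4 < (u + 2)^2] produces the summand [2].

    The differential equation and the nature of the zeros come from orthogonality.
    The functional [p |-> \int p(x) x^alpha e^(-x) dx] is positive on nonzero
    polynomials that are nonnegative on [(0, +oo)], and it vanishes on
    [(A - x) p + x p'] (integration by parts).  The second fact makes
    [D p = x p'' + (A - x) p'] symmetric, so that [g = D f + k f], of degree less
    than [k], is orthogonal to itself and vanishes.  The first fact excludes every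
    factorization [f = d h] with [d] nonconstant and nonnegative on [(0, +oo)], as
    [f] is orthogonal to [h] while [f h = d h^2]; nonreal, nonpositive and multiple
    zeros all give such a [d]. *)

(** * Integration over the positive half-line *)

Section ImproperIntegral.
Context {R : realType}.
Implicit Types (f F : R -> R) (x : R).
Let mu := @lebesgue_measure R.

(** The index shift keeps the left end strictly below the right end at [n =
    0]. *)
Definition exhaustion (n : nat) : set R := `[n.+2%:R^-1, n.+2%:R]%classic.

Lemma exhaustion_lt (n : nat) : (n.+2%:R^-1 : R) < n.+2%:R.
Proof.
have h : (1 : R) < n.+2%:R by rewrite ltr1n.
by apply: lt_trans h; rewrite invf_lt1 ?ltr0n ?ltr1n.
Qed.

Lemma exhaustion_gt0 n x : exhaustion n x -> 0 < x.
Proof.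
by rewrite /exhaustion /= in_itv /= => /andP[+ _]; apply: lt_le_trans; rewrite invr_gt0.
Qed.

Lemma exhaustion_nondecreasing : nondecreasing_seq exhaustion.
Proof.
apply/nondecreasing_seqP => n; rewrite subsetEset => x.
rewrite /exhaustion /= !in_itv /= => /andP[h1 h2]; apply/andP; split.
  by apply: le_trans h1; rewrite lef_pV2 ?posrE ?ltr0n // ler_nat.
by apply: (le_trans h2); rewrite ler_nat.
Qed.

Lemma exhaustion_eventually x : 0 < x -> \forall n \near \oo, exhaustion n x.
Proof.
move=> x0; near=> n.
rewrite /exhaustion /= in_itv /= -[X in _ <= X]invrK lef_pV2 ?posrE ?invr_gt0 ?ltr0n //.
apply/andP; split.
- have h : x^-1 <= n%:R by near: n; exact: nbhs_infty_ger.
  by apply: (le_trans h); rewrite ler_nat leqW.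
- have h : x <= n%:R by near: n; exact: nbhs_infty_ger.
  by apply: (le_trans h); rewrite ler_nat leqW.
Unshelve. all: by end_near. Qed.

Lemma bigcup_exhaustion : \bigcup_n exhaustion n = `]0, +oo[%classic.
Proof.
apply/seteqP; split=> x /=.
  by move=> [n _ /exhaustion_gt0]; rewrite in_itv /= andbT.
rewrite in_itv /= andbT => /exhaustion_eventually [n _ hn].
by exists n => //; apply: hn => /=.
Qed.

Lemma measurable_pos_continuous f : (forall x, 0 < x -> {for x, continuous f}) ->
  measurable_fun (`]0, +oo[ : set R) f.
Proof.
move=> cf; apply: open_continuous_measurable_fun => //.
by move=> x; rewrite inE /= in_itv /= andbT; exact: cf.
Qed.

Lemma exhaustion_FTC f F n : (forall x, 0 < x -> {for x, continuous f}) ->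
  (forall x, 0 < x -> is_derive x 1 F (f x)) ->
  (\int[mu]_(x in exhaustion n) (f x)%:E)%E = (F n.+2%:R - F n.+2%:R^-1)%:E.
Proof.
move=> cf dF; have cF x : 0 < x -> {for x, continuous F}.
  move=> x0; apply: differentiable_continuous; apply/derivable1_diffP.
  by have [] := dF _ x0.
rewrite /exhaustion (@continuous_FTC2 _ f F) ?EFinB //.
- exact: exhaustion_lt.
- by apply: continuous_in_subspaceT => x; rewrite inE => /exhaustion_gt0/cf.
- split.
  + by move=> x /subset_itv_oo_cc /exhaustion_gt0 /dF [].
  + by apply: cvg_at_right_filter; apply: cF; rewrite invr_gt0.
  + by apply: cvg_at_left_filter; apply: cF.
- move=> x /subset_itv_oo_cc /exhaustion_gt0 /dF [_ <-].
  by rewrite derive1E.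
Qed.

(** By monotone convergence, the integral is the limit of the increments of
    [F], which are at most [M]. *)
Lemma integrable_bounded_primitive f F M :
  (forall x, 0 < x -> {for x, continuous f}) ->
  (forall x, 0 < x -> 0 <= f x) ->
  (forall x, 0 < x -> is_derive x 1 F (f x)) ->
  (forall x, 0 < x -> 0 <= F x <= M) ->
  mu.-integrable (`]0, +oo[ : set R) (EFin \o f).
Proof.
move=> cf f0 dF FM.
have mf := measurable_pos_continuous cf.
apply/integrableP; split; first exact/measurable_EFinP.
apply: (@le_lt_trans _ _ M%:E); last exact: ltry.
under eq_integral => x.
  rewrite inE /= in_itv /= andbT => x0; rewrite ger0_norm ?f0 //; over.
rewrite -bigcup_exhaustion.
have h : (\int[mu]_(x in exhaustion i) (f x)%:E)%E @[i --> \oo] -->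
    (\int[mu]_(x in \bigcup_i exhaustion i) (f x)%:E)%E.
  apply: ge0_nondecreasing_set_cvg_integral.
  - exact: exhaustion_nondecreasing.
  - by move=> n; exact: measurable_itv.
  - move=> n; apply/measurable_EFinP; apply: measurable_funS mf => //.
    by move=> x /exhaustion_gt0; rewrite /= in_itv /= andbT.
  - by move=> n x /exhaustion_gt0 /f0; rewrite lee_fin.
rewrite -(cvg_lim _ h) //; apply: lime_le; first by apply/cvg_ex; eexists; exact: h.
apply: nearW => n; rewrite (exhaustion_FTC _ cf dF) lee_fin.
have /andP[_ h1] := FM n.+2%:R (ltr0Sn _ _).
have /andP[h2 _] : 0 <= F n.+2%:R^-1 <= M by apply: FM; rewrite invr_gt0.
lra.
Qed.

(** Dominated convergence along the exhaustion, with [|f|] itself as the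
    dominating function. *)
Lemma improper_FTC f F l :
  (forall x, 0 < x -> {for x, continuous f}) ->
  (forall x, 0 < x -> is_derive x 1 F (f x)) ->
  mu.-integrable (`]0, +oo[ : set R) (EFin \o f) ->
  F x @[x --> +oo] --> l -> F x @[x --> 0^'+] --> (0 : R) ->
  (\int[mu]_(x in `]0%R, +oo[) (f x)%:E)%E = l%:E.
Proof.
move=> cf dF intf Foo F0.
have mf := measurable_pos_continuous cf.
pose f_ n := ((EFin \o f) \_ (exhaustion n)).
have mJ n : measurable (exhaustion n) by exact: measurable_itv.
have J0 n : exhaustion n `<=` `]0, +oo[.
  by move=> x /exhaustion_gt0; rewrite /= in_itv /= andbT.
have h1 : (\int[mu]_(x in `]0%R, +oo[) f_ n x)%E @[n --> \oo] -->
    (\int[mu]_(x in `]0%R, +oo[) (f x)%:E)%E.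
  have := @dominated_cvg _ _ _ (@lebesgue_measure R) _ (@measurable_itv R `]0, +oo[).
  move=> /(_ f_ (EFin \o f) (abse \o (EFin \o f))).
  apply => //.
  - move=> n; apply/(measurable_restrict _ (mJ n)) => //.
    rewrite setIidr //; apply/measurable_EFinP; exact: measurable_funS mf.
  - move=> x /=; rewrite in_itv /= andbT => /exhaustion_eventually [N _ hN].
    apply: cvg_near_cst; exists N => // n /= Nn.
    by rewrite /f_ patchE mem_set //; apply: hN.
  - exact: integrable_abse.
  - by move=> n x _; rewrite /f_ patchE; case: ifP => //=; rewrite normr0 lee_fin.
have h2 n : (\int[mu]_(x in `]0%R, +oo[) f_ n x)%E = (F n.+2%:R - F n.+2%:R^-1)%:E.
  by rewrite /f_ -integral_mkcondr setIidr // (exhaustion_FTC _ cf dF).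
have ninf : (n.+2%:R : R) @[n --> \oo] --> +oo.
  apply/cvgryPge => M; near=> n.
  have h : M <= n%:R by near: n; exact: nbhs_infty_ger.
  by apply: (le_trans h); rewrite ler_nat !leqW.
have h3 : (F n.+2%:R - F n.+2%:R^-1)%:E @[n --> \oo] --> l%:E.
  apply: cvg_EFin; first by near=> n.
  rewrite /comp /= -[l]subr0; apply: cvgB.
    exact: cvg_comp ninf Foo.
  apply: (proj1 (cvg_at_rightP _ _ _) F0); split=> [n|]; first by rewrite invr_gt0.
  by apply/gtr0_cvgV0 => //; exact: nearW.
move: h1; under eq_fun do rewrite h2; move=> h1.
exact: cvg_unique h1 h3.
Unshelve. all: by end_near. Qed.

End ImproperIntegral.

(** * The weight function *)

Section LaguerreWeight.
Context {R : realType}.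
Implicit Types (b x y : R).
Let mu := @lebesgue_measure R.

(** A single term of the exponential series dominates [y ^ n] for an integer
    [n >= b]. *)
Lemma powR_le_expR b : exists2 C : R, 0 < C & forall y, 1 <= y -> y `^ b <= C * expR y.
Proof.
pose N := Num.bound `|b|.
exists (N.+1)`!%:R; first by rewrite ltr0n fact_gt0.
move=> y y1; have y0 : 0 <= y by lra.
have bN : b <= N.+1%:R.
  have := archi_boundP (normr_ge0 b); rewrite -/N => h.
  by apply: (le_trans (ler_norm b)); apply: (le_trans (ltW h)); rewrite ler_nat.
apply: (le_trans (ler_powR y1 bN)); rewrite powR_mulrn //.
have h := expR_ge1Dxn N y0; rewrite mulrC -ler_pdivrMr ?ltr0n ?fact_gt0 //; lra.
Qed.

Lemma laguerre_weight_ge0 b x : 0 <= laguerre_weight b x.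
Proof. by rewrite mulr_ge0 ?powR_ge0 ?expR_ge0. Qed.

Lemma laguerre_weight_gt0 b x : 0 < x -> 0 < laguerre_weight b x.
Proof. by move=> x0; rewrite mulr_gt0 ?powR_gt0 ?expR_gt0. Qed.

Lemma laguerre_weightMx b x : 0 < x -> laguerre_weight (b + 1) x = x * laguerre_weight b x.
Proof.
move=> x0; rewrite /laguerre_weight powRD ?powRr1 ?(ltW x0) //; first by ring.
by rewrite (gt_eqF x0) implybT.
Qed.

Lemma is_derive_laguerre_weight b x : 0 < x ->
  is_derive x 1 (laguerre_weight b) (b * laguerre_weight (b - 1) x - laguerre_weight b x).
Proof.
move=> x0; rewrite /laguerre_weight.
have h1 := is_derive1_powR b x0.
have h2 : is_derive x 1 (fun x : R => expR (- x)) (- expR (- x)).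
  by apply: is_derive_eq; rewrite /GRing.scale /=; ring.
apply: (is_derive_eq (is_deriveM h1 h2)).
by rewrite /GRing.scale /=; ring.
Qed.

Lemma continuous_laguerre_weight b x : 0 < x -> {for x, continuous (laguerre_weight b)}.
Proof.
move=> x0; apply: differentiable_continuous; apply/derivable1_diffP.
by have [] := is_derive_laguerre_weight b x0.
Qed.

Lemma laguerre_weight_cvgy b : laguerre_weight b x @[x --> +oo] --> (0 : R).
Proof.
have [C C0 hC] := powR_le_expR (b + 1).
apply: (@squeeze_cvgr _ _ _ _ (cst 0) (fun x => C * x^-1)).
- near=> x; rewrite laguerre_weight_ge0 /=.
  have x1 : 1 <= x by near: x; exact: nbhs_pinfty_ge.
  have x0 : 0 < x by lra.
  have := hC _ x1; rewrite -(@ler_pM2r _ (expR (- x))) ?expR_gt0 //.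
  rewrite -mulrA -expRD subrr expR0 mulr1 => h.
  by rewrite ler_pdivlMr // mulrC -laguerre_weightMx.
- exact: cvg_cst.
- rewrite -(mulr0 C); apply: cvgMr.
  by apply/gtr0_cvgV0; [exact: nbhs_pinfty_gt|exact: cvg_id].
Unshelve. all: by end_near. Qed.

Lemma laguerre_weight_cvg0 b : 0 < b -> laguerre_weight b x @[x --> 0^'+] --> (0 : R).
Proof.
move=> b0; have h1 := powR_cvg0 b0.
have h2 : expR (- x) @[x --> 0^'+] --> (1 : R).
  rewrite -[X in _ --> X](_ : expR (- 0) = 1); last by rewrite oppr0 expR0.
  apply: cvg_at_right_filter; apply: continuous_comp; first exact: continuousN.
  exact: continuous_expR.
rewrite -[X in _ --> X](mul0r (1 : R)); exact: cvgM h1 h2.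
Qed.

(** The function [G], bounded by [1], is a primitive on [(0, +oo)] of [g], which
    behaves as [x ^ b] at [0] and as [x ^ (- 2)] at infinity: up to a constant, it
    dominates [x ^ b e^(-x)] at both ends. *)
Let G b x := (x / (1 + x)) `^ (b + 1).
Let g b x := (b + 1) * (x / (1 + x)) `^ b * (1 + x) ^- 2.

Let ratio_itv x : 0 < x -> 0 < x / (1 + x) <= 1.
Proof.
by move=> x0; rewrite divr_gt0 ?ler_pdivrMr /=; lra.
Qed.

Let is_derive_G b x : 0 < x -> is_derive x 1 (G b) (g b x).
Proof.
move=> x0; have x1 : 1 + x != 0 by apply: lt0r_neq0; lra.
have h1 : is_derive x 1 (fun x : R => x / (1 + x)) ((1 + x) ^- 2).
  have h : is_derive x 1 (fun x : R => 1 + x) 1.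
    have := is_deriveD (is_derive_cst (1 : R) x (1 : R)) (is_derive_id x (1 : R)).
    by rewrite add0r.
  apply: (is_derive_eq (is_deriveM (is_derive_id x 1) (is_deriveV x1 h))).
  rewrite /GRing.scale /=; field; exact: x1.
have /andP[r0 _] := ratio_itv x0.
have h2 := is_derive1_powR (b + 1) r0.
have h3 := @is_derive1_comp _ (fun y => y `^ (b + 1)) (fun y => y / (1 + y)) x _ _ h2 h1.
apply: (is_derive_eq h3).
by rewrite /GRing.scale /= /g addrK; ring.
Qed.

Let continuous_g b x : 0 < x -> {for x, continuous (g b)}.
Proof.
move=> x0; have x1 : 1 + x != 0 by apply: lt0r_neq0; lra.
have c1 : {for x, continuous (fun x : R => (1 + x)^-1)}.
  apply: continuousV => //; apply: continuousD; [exact: cst_continuous | exact: cvg_id].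
have /andP[r0 _] := ratio_itv x0.
rewrite /g; apply: continuousM.
  apply: continuousM; first exact: cst_continuous.
  apply: (@continuous_comp _ _ _ (fun x => x / (1 + x)) (fun y => y `^ b)).
    by apply: continuousM => //; exact: cvg_id.
  apply: differentiable_continuous; apply/derivable1_diffP.
  by have [] := is_derive1_powR b r0.
have -> : (fun x : R => (1 + x) ^- 2) = (fun x => (1 + x)^-1 * (1 + x)^-1).
  by apply/funext => y; rewrite expr2 invfM.
exact: continuousM.
Qed.

Lemma integrable_laguerre_weight b : -1 < b ->
  mu.-integrable (`]0, +oo[ : set R) (EFin \o laguerre_weight b).
Proof.
move=> b1.
have ig : mu.-integrable (`]0, +oo[ : set R) (EFin \o g b).
  apply: (@integrable_bounded_primitive _ _ (G b) 1).
  - exact: continuous_g.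
  - move=> x x0; have /andP[r0 _] := ratio_itv x0.
    rewrite /g !mulr_ge0 ?powR_ge0 //; first lra.
    by rewrite invr_ge0 exprn_ge0 //; lra.
  - exact: is_derive_G.
  - move=> x x0; have /andP[r0 r1] := ratio_itv x0.
    rewrite /G powR_ge0 /=; rewrite -[leRHS](_ : 1 `^ (b + 1) = 1); last by rewrite powR1.
    by rewrite ge0_ler_powR ?nnegrE; lra.
have [C C0 hC] := powR_le_expR (b + 2).
(* With [(1 + x) ^ (b + 2) <= C e^(1 + x)], the constant [K] makes [K g] at least
   [x ^ b e^(-x)]. *)
pose K := C * expR 1 / (b + 1).
have := @le_integrable _ _ _ (@lebesgue_measure R) _ (@measurable_itv R `]0, +oo[).
move=> /(_ (EFin \o laguerre_weight b) (fun x => (K%:E * (g b x)%:E)%E)).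
apply => //.
- by apply/measurable_EFinP; apply: measurable_pos_continuous; exact: continuous_laguerre_weight.
- move=> x /=; rewrite in_itv /= andbT => x0.
  have x10 : 0 < 1 + x by lra.
  rewrite /= lee_fin ger0_norm ?laguerre_weight_ge0 //.
  apply: le_trans (ler_norm _).
  have eI : (1 + x)^-1 `^ b = ((1 + x) `^ b)^-1.
    by rewrite -powR_inv1 ?(ltW x10) // -powRrM mulN1r powRN.
  have -> : K * g b x = x `^ b * ((1 + x) `^ (b + 2))^-1 * (C * expR 1).
    rewrite /K /g powRM ?(ltW x0) ?invr_ge0 ?(ltW x10) //.
    rewrite eI powRD; last first.
      by rewrite (gt_eqF x10) implybT.
    rewrite -[2]/(2%:R) powR_mulrn ?(ltW x10) //.
    have e1 : (1 + x) `^ b != 0 by rewrite gt_eqF ?powR_gt0.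
    field; rewrite e1 !gt_eqF //; lra.
  rewrite /laguerre_weight -mulrA ler_wpM2l ?powR_ge0 //.
  rewrite ler_pdivlMl ?powR_gt0 //.
  have h1 : 1 <= 1 + x by lra.
  have := hC _ h1; rewrite expRD => h2.
  rewrite -(ler_pM2r (expR_gt0 x)) -mulrA -expRD addNr expR0 mulr1; lra.
- exact: integrableZl.
Qed.

(** The integrand is the derivative of [x ^ b e^(-x)], which vanishes at both
    ends. *)
Lemma laguerre_moment_rec b : 0 < b ->
  (\int[mu]_(x in `]0%R, +oo[) (b * laguerre_weight (b - 1) x - laguerre_weight b x)%:E)%E = 0%E.
Proof.
move=> b0.
apply: (@improper_FTC _ _ (laguerre_weight b)).
- move=> x x0; apply: continuousB; last exact: continuous_laguerre_weight.
  apply: continuousM; first exact: cst_continuous.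
  exact: continuous_laguerre_weight.
- by move=> x; exact: is_derive_laguerre_weight.
- have h1 : mu.-integrable (`]0, +oo[ : set R) (EFin \o laguerre_weight (b - 1)).
    by apply: integrable_laguerre_weight; lra.
  have h2 : mu.-integrable (`]0, +oo[ : set R) (EFin \o laguerre_weight b).
    by apply: integrable_laguerre_weight; lra.
  exact: (integrableB _ (integrableZl _ _ h1) h2).
- exact: laguerre_weight_cvgy.
- exact: laguerre_weight_cvg0.
Qed.

End LaguerreWeight.

(** * Integration of polynomials against the weight *)

Section LaguerreFunctional.
Context {R : realType}.
Implicit Types (a x : R) (p q : {poly R}).
Let mu := @lebesgue_measure R.

Definition laguerre_functional a p : R :=
  \int[mu]_(x in `]0, +oo[) (p.[x] * laguerre_weight a x).

(** Multiplication by [x] is absorbed by the weight; this lets inductions on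
    [p = q * 'X + c] vary the parameter instead of expanding [p] into
    monomials. *)
Lemma laguerre_functional_mulX a p :
  laguerre_functional a (p * 'X) = laguerre_functional (a + 1) p.
Proof.
apply: eq_Rintegral => x; rewrite inE /= in_itv /= andbT => x0.
by rewrite hornerMX laguerre_weightMx //; ring.
Qed.

Lemma integrable_laguerre a p : -1 < a ->
  mu.-integrable (`]0, +oo[ : set R) (fun x => (p.[x] * laguerre_weight a x)%:E).
Proof.
elim/poly_ind: p a => [|p c IHp] a a1.
  apply: (eq_integrable _ (fun=> 0%E)) => //; last exact: integrable0.
  by move=> x _; rewrite horner0 mul0r.
have a2 : -1 < a + 1 by lra.
have h : mu.-integrable (`]0, +oo[ : set R) (fun x => (p.[x] * laguerre_weight (a + 1) x)%:E
    + c%:E * (laguerre_weight a x)%:E)%E.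
  by exact: (integrableD _ (IHp _ a2) (integrableZl _ c (integrable_laguerre_weight a1))).
apply: (eq_integrable _ _ _ _ h) => // x.
rewrite inE /= in_itv /= andbT => x0.
by rewrite hornerD hornerC hornerMX laguerre_weightMx // -EFinD; congr EFin; ring.
Qed.

Lemma laguerre_functionalD a p q : -1 < a ->
  laguerre_functional a (p + q) = laguerre_functional a p + laguerre_functional a q.
Proof.
move=> a1; rewrite -RintegralD //; try exact: integrable_laguerre.
by apply: eq_Rintegral => x _; rewrite hornerD; ring.
Qed.

Lemma laguerre_functionalZ a (c : R) p : -1 < a ->
  laguerre_functional a (c *: p) = c * laguerre_functional a p.
Proof.
move=> a1; rewrite -RintegralZl //; last exact: integrable_laguerre.
by apply: eq_Rintegral => x _; rewrite hornerZ; ring.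
Qed.

Lemma laguerre_functionalE a p : -1 < a ->
  (\int[mu]_(x in `[0%R, +oo[) (p.[x] * laguerre_weight a x)%:E)%E =
  (laguerre_functional a p)%:E.
Proof.
move=> a1; have ip := integrable_laguerre p a1.
rewrite -integral_itv_obnd_cbnd; last by have /integrableP[] := ip.
by rewrite /laguerre_functional /Rintegral fineK //; exact: integrable_fin_num.
Qed.

(** The integrand is the derivative of [x ^ (a + 1) e^(-x) p(x)]. In the
    induction, the part [q * 'X] of [p] contributes the same expression for
    [q] and [a + 1], and the constant contributes the moment recurrence. *)
Lemma laguerre_by_parts a p : -1 < a ->
  laguerre_functional a (((a + 1)%:P - 'X) * p + 'X * p^`()) = 0.
Proof.
elim/poly_ind: p a => [|p c IHp] a a1.
  by rewrite linear0 !mulr0 addr0 -(scale0r 0) laguerre_functionalZ ?mul0r.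
have a2 : -1 < a + 1 by lra.
have -> : ((a + 1)%:P - 'X) * (p * 'X + c%:P) + 'X * (p * 'X + c%:P)^`() =
    (((a + 1 + 1)%:P - 'X) * p + 'X * p^`()) * 'X + c *: ((a + 1)%:P - 'X).
  rewrite derivD derivM derivX derivC -mul_polyC polyCD polyC1; ring.
rewrite laguerre_functionalD // laguerre_functional_mulX IHp // add0r.
rewrite laguerre_functionalZ // [X in c * X](_ : _ = 0) ?mulr0 //.
have a3 : 0 < a + 1 by lra.
have := laguerre_moment_rec a3; rewrite addrK => h.
rewrite /laguerre_functional /Rintegral.
under eq_integral => x.
  rewrite inE /= in_itv /= andbT => x0.
  rewrite hornerD hornerN hornerC hornerX mulrBl -laguerre_weightMx //; over.
by rewrite h.
Qed.

(** If the integral were zero, the integrand would vanish almost everywhere,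
    whereas it vanishes only at the finitely many roots of [p]. *)
Lemma laguerre_functional_gt0 a p : -1 < a -> p != 0 ->
  (forall x, 0 < x -> 0 <= p.[x]) -> 0 < laguerre_functional a p.
Proof.
move=> a1 p0 pge0.
have fge0 x : (`]0, +oo[%classic : set R) x -> 0 <= p.[x] * laguerre_weight a x.
  by rewrite /= in_itv /= andbT => x0; rewrite mulr_ge0 ?pge0 ?laguerre_weight_ge0.
rewrite lt_def Rintegral_ge0 // andbT; apply/eqP => L0.
have ip := integrable_laguerre p a1; have /integrableP[mp _] := ip.
have : (\int[mu]_(x in (`]0%R, +oo[)) `|(p.[x] * laguerre_weight a x)%:E|)%E = 0%E.
  under eq_integral => x.
    rewrite inE => /fge0 h; rewrite gee0_abs ?lee_fin //; over.
  rewrite -[LHS]fineK; last exact: integrable_fin_num.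
  by rewrite -[fine _]/(laguerre_functional a p) L0.
move=> h0.
have ae0 : mu.-negligible (~` [set x | (`]0, +oo[%classic : set R) x ->
    (p.[x] * laguerre_weight a x)%:E = 0%E]).
  by have := proj1 (ae_eq_integral_abs _ _ _) h0; exact.
have cZ : mu [set` rootsR p] = 0%E.
  exact/countable_lebesgue_measure0/finite_set_countable/finite_seq.
have : mu.-negligible (`]0, +oo[%classic : set R).
  apply: (negligibleS _ (negligibleU ae0 (proj2 (negligibleP _ _) cZ))).
  - move=> x x0; case: (boolP (x \in rootsR p)) => [|xr]; first by right.
    left => /= h; case: (h x0) => /eqP.
    have {}x0 : 0 < x by move: x0; rewrite /= in_itv /= andbT.
    rewrite mulf_eq0 (gt_eqF (laguerre_weight_gt0 _ x0)) orbF => px0.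
    by move: xr; rewrite -roots_on_rootsR // in_itv /= /root px0.
  - by apply: countable_measurable; [exact: measurable_set1
      | exact/finite_set_countable/finite_seq].
move=> negl; have : mu (`]0, +oo[%classic : set R) = 0%E.
  by apply: (proj1 (negligibleP _ _) negl).
by rewrite /mu lebesgue_measure_itv /= ltry.
Qed.

End LaguerreFunctional.

(** * The Laguerre differential equation *)

Section LaguerreEquation.
Context {R : realType}.
Variable a : R.
Hypothesis a1 : -1 < a.
Implicit Types (p q f g : {poly R}).

Local Notation Lf := (laguerre_functional a).

Lemma laguerre_functional0 : Lf 0 = 0.
Proof. by rewrite -(scale0r 0) laguerre_functionalZ // mul0r. Qed.

Lemma laguerre_functional_sqr_eq0 p : Lf (p * p) = 0 -> p = 0.
Proof.
move=> pp0; apply/eqP/contraT => p0.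
suff : 0 < Lf (p * p) by rewrite pp0 ltxx.
apply: laguerre_functional_gt0 => //; first by rewrite mulf_neq0.
by move=> x _; rewrite hornerM -expr2 sqr_ge0.
Qed.

Definition laguerre_operator p : {poly R} :=
  'X * p^`()^`() + ((a + 1)%:P - 'X) * p^`().

Lemma coef_laguerre_operator p j :
  (laguerre_operator p)`_j = j.+1%:R * (j%:R + a + 1) * p`_j.+1 - j%:R * p`_j.
Proof.
rewrite coefD mulrBl coefB coefCM !coefXM !coef_deriv.
case: j => [|j] /=; first by ring.
ring.
Qed.

Lemma size_laguerre_operator p : (size (laguerre_operator p) <= size p)%N.
Proof.
apply/leq_sizeP => j pj; rewrite coef_laguerre_operator !nth_default ?(leqW pj) //.
by rewrite !mulr0 subrr.
Qed.

(** By parts, both sides equal minus the integral of [x p' q'] against the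
    weight. *)
Lemma laguerre_operator_sym p q :
  Lf (laguerre_operator p * q) = Lf (p * laguerre_operator q).
Proof.
have h r s : Lf (laguerre_operator r * s) = - Lf ('X * r^`() * s^`()).
  apply/eqP; rewrite -addr_eq0 -laguerre_functionalD //.
  rewrite -[X in _ == X](laguerre_by_parts (r^`() * s) a1); apply/eqP; congr Lf.
  by rewrite /laguerre_operator derivM; ring.
rewrite h [p * _]mulrC h; congr (- Lf _); ring.
Qed.

(** The left-hand side [g] has degree less than [k], since the coefficients of
    [x ^ k] cancel. By symmetry [g] is orthogonal to itself: [<g, g> = <f, D g
    + k g> = 0]. *)
Lemma laguerre_orthogonal_equation f k : size f = k.+1 ->
  (forall q, (size q <= k)%N -> Lf (f * q) = 0) ->
  laguerre_operator f + k%:R *: f = 0.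
Proof.
move=> sf orth; set g := _ + _.
have sg : (size g <= k)%N.
  apply/leq_sizeP => j kj; rewrite coefD coefZ coef_laguerre_operator.
  rewrite [f`_j.+1]nth_default ?sf // mulr0 sub0r.
  case: (eqVneq j k) => [->|jk]; first by ring.
  by rewrite [f`_j]nth_default ?sf 1?ltn_neqAle 1?eq_sym ?jk // !mulr0 oppr0 addr0.
apply: laguerre_functional_sqr_eq0.
rewrite {1}/g mulrDl laguerre_functionalD // laguerre_operator_sym.
rewrite orth; last by rewrite (leq_trans (size_laguerre_operator g)).
by rewrite -scalerAl laguerre_functionalZ // orth // mulr0 addr0.
Qed.

(** The [L n] with [n < k] span the polynomials of degree less than [k]; the
    leading term is removed step by step. *)
Lemma laguerre_polynomials_orthogonal L k : laguerre_polynomials a L ->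
  forall q, (size q <= k)%N -> Lf (L k * q) = 0.
Proof.
move=> [sL oL] q; move: {2}(size q) (leqnn (size q)) => n.
elim: n q => [|n IHn] q qn qk.
  by move: qn; rewrite leqn0 size_poly_eq0 => /eqP ->; rewrite mulr0 laguerre_functional0.
case: (leqP (size q) n) => [|nq]; first by move/IHn; apply.
have sq : size q = n.+1 by apply/eqP; rewrite eqn_leq qn nq.
have nk : (n < k)%N by rewrite -sq.
have lc0 : (L n)`_n != 0.
  have -> : (L n)`_n = lead_coef (L n) by rewrite lead_coefE sL.
  by rewrite lead_coef_eq0 -size_poly_eq0 sL.
pose c := q`_n / (L n)`_n.
have -> : q = (q - c *: L n) + c *: L n by rewrite subrK.
rewrite mulrDr laguerre_functionalD // -scalerAr laguerre_functionalZ //.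
have -> : Lf (L k * L n) = 0.
  apply: EFin_inj; rewrite -laguerre_functionalE //.
  apply: etrans (oL k n _); last by rewrite gtn_eqF.
  by apply: eq_integral => x _; rewrite hornerM.
rewrite mulr0 addr0; have h : (size (q - c *: L n)%R <= n)%N.
  apply/leq_sizeP => j; rewrite coefB coefZ leq_eqVlt => /orP[/eqP <-|nj].
    by rewrite /c divfK // subrr.
  by rewrite !nth_default ?sL ?sq // mulr0 subrr.
by apply: IHn => //; apply: leq_trans h (ltnW nk).
Qed.

End LaguerreEquation.

(** * Real polynomials without nonreal roots *)

Section RealRooted.
Local Open Scope complex_scope.

(** A complex root [u + i v] is either real or a root of the real polynomial
    [(x - u)^2 + v^2]; the remainder modulo the latter is of degree at most
    [1] and vanishes at a nonreal point, hence is zero. *)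
Lemma real_poly_factor (R : rcfType) (p : {poly R}) : (1 < size p)%N ->
  (exists u, root p u) \/
  (exists u v, v != 0 /\ ('X - u%:P) ^+ 2 + (v ^+ 2)%:P %| p).
Proof.
move=> p1; pose C (q : {poly R}) := map_poly (real_complex R) q.
have /closed_rootP [[u v] zr] : size (C p) != 1%N by rewrite size_map_poly gtn_eqF.
have [v0|v0] := eqVneq v 0.
  by left; exists u; move: zr; rewrite v0 fmorph_root.
right; exists u, v; split=> //.
set d := _ + _; set z := (u +i* v)%C in zr.
have sd : size d = 3%N.
  rewrite /d size_polyDl ?size_exp_XsubC //.
  by rewrite size_polyC; case: eqP.
have dr : (C d).[z] = 0.
  rewrite /C /d rmorphD rmorphXn rmorphB /= map_polyX !map_polyC /= !hornerE.
  by apply/eqP; rewrite eq_complex /= ; apply/andP; split; apply/eqP; rewrite ?expr2 /=; ring.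
have sr : (size (p %% d)%R <= 2)%N by rewrite -ltnS -sd ltn_modp -size_poly_eq0 sd.
have rr : (C (p %% d)).[z] = 0.
  move: zr; rewrite /root {1}(divp_eq p d) /C rmorphD rmorphM /= hornerD hornerM.
  by rewrite -/(C d) dr mulr0 add0r => /eqP.
have pE : p %% d = ((p %% d)`_0)%:P + (p %% d)`_1 *: 'X.
  apply/polyP => -[|[|j]]; rewrite !coefE /= ?mulr0 ?mulr1 ?addr0 ?add0r //.
  by rewrite nth_default // (leq_trans sr).
move: rr; rewrite pE /C rmorphD /= map_polyZ map_polyC map_polyX /= !hornerE.
move=> /eqP; rewrite eq_complex /= => /andP[/eqP e1 /eqP e2].
have r1 : (p %% d)`_1 = 0.
  by apply/eqP; rewrite -(mulIr_eq0 _ (mulIf v0)); apply/eqP; lra.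
have r0 : (p %% d)`_0 = 0 by move: e1; rewrite r1; lra.
by rewrite /dvdp pE r0 r1 scale0r polyC0 addr0.
Qed.

End RealRooted.

(** All complex roots are real, expressed through the absence of a real
    quadratic factor with the nonreal roots [u +/- i v]. *)
Definition real_rooted (R : rcfType) (p : {poly R}) :=
  forall u v, v != 0 -> ~~ (('X - u%:P) ^+ 2 + (v ^+ 2)%:P %| p).

Lemma real_rooted_dvd (R : rcfType) (p q : {poly R}) : q %| p -> real_rooted p -> real_rooted q.
Proof. by move=> qp rp u v v0; apply/negP => /dvdp_trans/(_ qp); apply/negP/rp. Qed.

(** For [p = q (x - u)] one has [p'^2 - p p'' = q^2 + (x - u)^2 (q'^2 - q
    q'')], so the inequality passes from [q] to [p]. *)
Lemma laguerre_inequality (R : rcfType) (p : {poly R}) (x : R) : real_rooted p ->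
  p.[x] * p^`()^`().[x] <= p^`().[x] ^+ 2.
Proof.
move: {2}(size p) (leqnn (size p)) => n; elim: n p => [|n IHn] p pn rp.
  by move: pn; rewrite leqn0 size_poly_eq0 => /eqP ->; rewrite horner0 mul0r sqr_ge0.
have [p1|p1] := leqP (size p) 1.
  by rewrite (size1_polyC p1) derivC deriv0 horner0 mulr0 sqr_ge0.
have [[u /factor_theorem[q pE]]|[u [v [v0 d]]]] := real_poly_factor p1; last first.
  by have := rp u v v0; rewrite d.
have q0 : q != 0 by apply/eqP => q0; move: p1; rewrite pE q0 mul0r size_poly0.
have /IHn /(_ _) IH : (size q <= n)%N.
  by move: pn; rewrite pE size_Mmonic ?monicXsubC // size_XsubC addn2.
have {}IH : q.[x] * q^`()^`().[x] <= q^`().[x] ^+ 2.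
  by apply: IH; apply: real_rooted_dvd rp; rewrite pE dvdp_mulIl.
rewrite pE !(derivM, derivXsubC, derivD, derivC, mulr1, mulr0, addr0) !hornerE.
have := sqr_ge0 q.[x]; have := sqr_ge0 (x - u); nra.
Qed.

Definition horner_opsE := (hornerD, hornerN, hornerM, hornerX, hornerC, hornerXsubC, hornerZ).

(** * Critical points beyond an extreme zero *)

Section CriticalPoint.
Context {R : rcfType}.
Variables (A : R) (k : nat) (f h : {poly R}) (z : R).
Hypothesis A0 : 0 < A.
Hypothesis fE : f = ('X - z%:P) * h.
Hypothesis z0 : 0 < z.
Hypothesis hz : h.[z] != 0.

(* The zeros of [P] are the points where [2 x f' = (x - A) f]. *)
Let P : {poly R} := 2%:P * 'X * f^`() - ('X - A%:P) * f.

(** By the inequality [h'^2 - h h'' >= 0], [f'^2 - f f'' >= h^2] at [x];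
    multiplying by [4 x^2] and eliminating [f'] and [f''] leaves a multiple of
    [h^2]. *)
Lemma critical_point_bound x :
  'X * f^`()^`() + (A%:P - 'X) * f^`() + k%:R *: f = 0 ->
  real_rooted h -> 0 < x -> f.[x] != 0 ->
  2 * x * f^`().[x] = (x - A) * f.[x] ->
  4 * x ^+ 2 <= (4 * k%:R * x - (x - A) ^+ 2) * (x - z) ^+ 2.
Proof.
move=> ode rh x0 fx0 crit.
have := laguerre_inequality x rh.
set H := h.[x]; set H1 := h^`().[x]; set H2 := h^`()^`().[x] => lag.
have ode' : x * f^`()^`().[x] + (A - x) * f^`().[x] + k%:R * f.[x] = 0.
  by rewrite -[RHS](horner0 x) -ode !horner_opsE.
have f0E : f.[x] = (x - z) * H by rewrite fE !horner_opsE.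
have f1E : f^`().[x] = H + (x - z) * H1.
  by rewrite fE derivM derivXsubC mul1r !horner_opsE.
have f2E : f^`()^`().[x] = 2 * H1 + (x - z) * H2.
  rewrite fE derivM derivXsubC mul1r derivD derivM derivXsubC mul1r addrA -mulr2n.
  by rewrite hornerD hornerMn hornerM hornerXsubC mulr_natl.
move: fx0 crit ode'; rewrite f0E f1E f2E mulf_eq0 negb_or => /andP[xz H0] crit ode'.
have H20 : 0 < H ^+ 2 by rewrite exprn_even_gt0.
rewrite -(ler_pM2r H20).
set F1 := H + (x - z) * H1 in crit ode'.
set F2 := 2 * H1 + (x - z) * H2 in ode'.
have e1 : F1 ^+ 2 - (x - z) * H * F2 = H ^+ 2 + (x - z) ^+ 2 * (H1 ^+ 2 - H * H2).
  by rewrite /F1 /F2; ring.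
have e2 : 0 <= (x - z) ^+ 2 * (H1 ^+ 2 - H * H2) by rewrite mulr_ge0 ?sqr_ge0 // subr_ge0.
have e3 : x ^+ 2 * H ^+ 2 <= x ^+ 2 * (F1 ^+ 2 - (x - z) * H * F2).
  by rewrite ler_wpM2l ?sqr_ge0 // e1 lerDl.
have e4 : 4 * (x ^+ 2 * (F1 ^+ 2 - (x - z) * H * F2)) =
   (2 * x * F1) ^+ 2 - 4 * x * ((x - z) * H) * (x * F2) by ring.
have e5 : x * F2 = - ((A - x) * F1 + k%:R * ((x - z) * H)).
  by clearbody F1 F2; lra.
have e6 : 4 * x * ((x - z) * H) * (x * F2) =
  - (2 * ((x - z) * H) * (A - x) * (2 * x * F1) + 4 * k%:R * x * ((x - z) * H) ^+ 2).
  by rewrite e5; ring.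
have e7 : 4 * (x ^+ 2 * (F1 ^+ 2 - (x - z) * H * F2)) =
   (4 * k%:R * x - (x - A) ^+ 2) * (x - z) ^+ 2 * H ^+ 2.
  by rewrite e4 e6 crit; ring.
lra.
Qed.

Let P_z : P.[z] = 2 * z * h.[z].
Proof. rewrite /P fE derivM derivXsubC mul1r !horner_opsE subrr; ring. Qed.

(** [P] takes the values [A f(0) = - A z h(0)] at [0] and [2 z h(z)] at [z],
    of opposite signs since [h] does not vanish between them. *)
Lemma critical_point_below : (forall y, root h y -> z <= y) ->
  exists x, [/\ 0 < x, x < z & 2 * x * f^`().[x] = (x - A) * f.[x]].
Proof.
move=> hmin.
have nr : {in `[0, z], forall r, ~~ root h r}.
  move=> r; rewrite in_itv /= => /andP[_ rz]; apply/negP => hr.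
  by move: hz; rewrite -[X in h.[X]](@le_anti _ _ r z) ?rz ?hmin // -/(root h r) hr.
have hh : 0 < h.[0] * h.[z].
  by apply: (noroot_noivt nr); rewrite in_itv /= lexx (ltW z0).
have [|x] := @poly_ivtoo _ P 0 z (ltW z0).
  rewrite P_z /P fE !horner_opsE.
  rewrite (_ : _ * _ = - (2 * A * z ^+ 2 * (h.[0] * h.[z]))); last by ring.
  by rewrite oppr_lt0 mulr_gt0 // mulr_gt0 ?exprn_gt0 // mulr_gt0 ?ltr0n.
rewrite in_itv /= => /andP[x0 xz] /rootP Px; exists x; split=> //.
by apply: subr0_eq; rewrite -Px /P !horner_opsE.
Qed.

(** The sign of [P] at [z] is that of [h], whereas its leading coefficient is
    opposite to that of [h]. *)
Lemma critical_point_above : (forall y, root h y -> y <= z) ->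
  exists x, [/\ z < x & 2 * x * f^`().[x] = (x - A) * f.[x]].
Proof.
move=> hmax; apply: contrapT => nox.
have h0 : h != 0 by apply/eqP => h0; move: hz; rewrite h0 horner0 eqxx.
have f0 : f != 0 by rewrite fE mulf_neq0 // polyXsubC_eq0.
have nrh : {in `[z, +oo[, forall r, ~~ root h r}.
  move=> r; rewrite in_itv /= andbT => zr; apply/negP => hr.
  by move: hz; rewrite -[X in h.[X]](@le_anti _ _ r z) ?zr ?hmax // -/(root h r) hr.
have nrP : {in `[z, +oo[, forall r, ~~ root P r}.
  move=> r; rewrite in_itv /= andbT le_eqVlt => /orP[/eqP <-|zr].
    by rewrite /root P_z !mulf_eq0 pnatr_eq0 (gt_eqF z0) (negPf hz).
  apply/negP => /rootP Pr; apply: nox; exists r; split=> //.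
  by apply: subr0_eq; rewrite -Pr /P !horner_opsE.
have zz : z \in `[z, +oo[ by rewrite in_itv /= lexx.
have := sgp_pinftyP nrP zz; have := sgp_pinftyP nrh zz.
have lP : lead_coef P = - lead_coef h.
  rewrite /P addrC lead_coefDl.
    by rewrite lead_coefN lead_coef_monicM ?monicXsubC // fE lead_coef_monicM ?monicXsubC.
  rewrite size_polyN [X in (_ < X)%N]size_monicM ?monicXsubC // size_XsubC /=.
  rewrite -mulrA size_Cmul ?pnatr_eq0 // ltnS.
  apply: leq_trans (size_polyMleq _ _) _.
  by rewrite size_polyX; exact: lt_size_deriv.
rewrite /sgp_pinfty lP sgrN P_z !sgrM => ->.
rewrite (gtr0_sg z0) gtr0_sg ?ltr0n // !mul1r => /eqP; rewrite -addr_eq0 -mulr2n mulrn_eq0 /=.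
by rewrite sgr_eq0 lead_coef_eq0 (negPf h0).
Qed.
End CriticalPoint.

(** * Zeros of an orthogonal polynomial *)

Section ZeroStructure.
Context {R : realType}.
Variables (a : R) (f : {poly R}) (k : nat).
Hypothesis a1 : -1 < a.
Hypothesis sf : size f = k.+1.
Hypothesis orth : forall q : {poly R}, (size q <= k)%N -> laguerre_functional a (f * q) = 0.

(** If [d >= 0] on [(0, +oo)], then [f h = d h^2] has a positive integral,
    although [h] has degree less than [k]. *)
Lemma orthogonal_no_nonneg_factor d h : f = d * h -> (1 < size d)%N ->
  exists x, 0 < x /\ d.[x] < 0.
Proof.
move=> fE d1; apply: contrapT => nox.
have f0 : f != 0 by rewrite -size_poly_eq0 sf.
move: (f0); rewrite {1}fE mulf_eq0 negb_or => /andP[d0 h0].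
suff : 0 < laguerre_functional a (f * h).
  rewrite orth ?ltxx // -ltnS -sf fE size_mul //.
  by move: d1; case: (size d) => [|[|n]] // _; rewrite !addSn /= ltnS leq_addl.
apply: laguerre_functional_gt0 => //; first by rewrite mulf_neq0.
move=> x x0; rewrite fE !hornerM -mulrA -expr2 mulr_ge0 ?sqr_ge0 //.
by rewrite leNgt; apply/negP => dx; apply: nox; exists x.
Qed.

Lemma orthogonal_real_rooted : real_rooted f.
Proof.
move=> u v v0; apply/negP => /dvdpP[h]; rewrite mulrC => fE.
have [|x [_]] := orthogonal_no_nonneg_factor fE.
  by rewrite size_polyDl ?size_exp_XsubC // size_polyC; case: eqP.
by rewrite hornerD horner_exp hornerC ltNge addr_ge0 ?sqr_ge0.
Qed.

Lemma orthogonal_root_gt0 z : root f z -> 0 < z.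
Proof.
move=> /factor_theorem[h]; rewrite mulrC => fE.
have [|x [x0]] := orthogonal_no_nonneg_factor fE; first by rewrite size_XsubC.
by rewrite hornerXsubC subr_lt0; exact: lt_trans.
Qed.

Lemma orthogonal_root_simple z h : f = ('X - z%:P) * h -> h.[z] != 0.
Proof.
move=> fE; apply/negP => /factor_theorem[g hE].
have {}fE : f = ('X - z%:P) ^+ 2 * g by rewrite fE hE; ring.
have [|x [_]] := orthogonal_no_nonneg_factor fE; first by rewrite size_exp_XsubC.
by rewrite horner_exp ltNge sqr_ge0.
Qed.

End ZeroStructure.

(** * From the critical-point inequality to the bounds *)

Section Arithmetic.
Context {R : realFieldType}.
Implicit Types (r s t x y u z : R).

(** The difference has a double zero at [u = 2 y] and a zero at [u = - y / 4],
    whence the factorization. *)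
Lemma cubic_amgm y u : 0 <= y -> 0 <= u -> 27 * (y * u ^+ 2) <= 4 * (y + u) ^+ 3.
Proof.
move=> y0 u0; rewrite -subr_ge0.
have -> : 4 * (y + u) ^+ 3 - 27 * (y * u ^+ 2) = (2 * y - u) ^+ 2 * (y + 4 * u) by ring.
by rewrite mulr_ge0 ?sqr_ge0 //; lra.
Qed.

(** The right-hand side is positive, so [x] lies between the roots [Q] and [S]
    of the quadratic. *)
Lemma band_of_bound S Q x z : 0 < x -> Q < S ->
  4 * x ^+ 2 <= (S - x) * (x - Q) * (x - z) ^+ 2 -> Q < x /\ x < S.
Proof.
move=> x0 QS h.
have h1 : 0 < (S - x) * (x - Q) * (x - z) ^+ 2.
  by apply: lt_le_trans h; rewrite mulr_gt0 ?exprn_gt0 ?ltr0n.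
have h2 : 0 < (S - x) * (x - Q).
  by rewrite ltNge; apply/negP => h2; move: h1; rewrite ltNge mulr_le0_ge0 ?sqr_ge0.
by split; nra.
Qed.

(** The bound gives [27 x^2 <= (z - Q)^3 (S - x)]; as [x > Q], this exceeds
    [27 Q^2 = (3 t)^3 (S - Q)], while [S - x < S - Q]. *)
Lemma lower_bound_of_critical S Q t x z : 0 <= Q -> Q < S -> 0 <= t ->
  t ^+ 3 * (S - Q) = Q ^+ 2 -> 0 < x -> x < z ->
  4 * x ^+ 2 <= (S - x) * (x - Q) * (x - z) ^+ 2 -> Q + 3 * t < z.
Proof.
move=> Q0 QS t0 t3 x0 xz h; have [Qx xS] := band_of_bound x0 QS h.
rewrite -subr_gt0; set d := z - Q.
have dE : (x - Q) + (z - x) = d by rewrite /d; ring.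
have y0 : 0 <= x - Q by lra.
have u0 : 0 <= z - x by lra.
have am := cubic_amgm y0 u0; rewrite dE in am.
rewrite (_ : _ - _ = d - 3 * t); last by rewrite /d; ring.
rewrite subr_gt0 ltNge; apply/negP => dt.
have d0 : 0 <= d by rewrite /d; lra.
have d3 : d ^+ 3 <= (3 * t) ^+ 3 by rewrite lerXn2r ?nnegrE //; lra.
have sx : 0 < S - x by lra.
have e1 : 27 * x ^+ 2 <= d ^+ 3 * (S - x).
  have := ler_wpM2r (ltW sx) am.
  have -> : (x - Q) * (z - x) ^+ 2 = (x - Q) * (x - z) ^+ 2 by ring.
  by clear am; lra.
have e2 : d ^+ 3 * (S - x) <= 27 * (t ^+ 3 * (S - x)).
  by have := ler_wpM2r (ltW sx) d3; rewrite exprMn; lra.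
have e3 : t ^+ 3 * (S - x) <= t ^+ 3 * (S - Q).
  by rewrite ler_wpM2l ?exprn_ge0 //; lra.
have e4 : Q ^+ 2 < x ^+ 2 by rewrite ltrXn2r ?nnegrE //; lra.
lra.
Qed.

(** Since [x^2 / (x - Q)] increases with slope less than [1] where it
    increases, replacing [x] by [S] costs at most [S - x]; that loss is what
    the summand [2] pays for. *)
Lemma upper_bound_of_critical S Q t x z : 0 <= Q -> Q < S -> 0 <= t ->
  t ^+ 3 * (S - Q) = S ^+ 2 -> 0 < x -> z < x ->
  4 * x ^+ 2 <= (S - x) * (x - Q) * (x - z) ^+ 2 -> z < S - 3 * t + 2.
Proof.
move=> Q0 QS t0 t3 x0 zx h; have [Qx xS] := band_of_bound x0 QS h.
set y := S - x; set u := x - z.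
have y0 : 0 < y by rewrite /y; lra.
have u0 : 0 < u by rewrite /u; lra.
have xQ : 0 < x - Q by lra.
have SQ : 0 < S - Q by lra.
(* x^2 / (x - Q) - x = Q + Q^2 / (x - Q) decreases in x *)
have phi : t ^+ 3 - y <= x ^+ 2 / (x - Q).
  have -> : t ^+ 3 = S ^+ 2 / (S - Q) by rewrite -t3 mulfK // gt_eqF.
  rewrite -subr_ge0.
  have -> : x ^+ 2 / (x - Q) - (S ^+ 2 / (S - Q) - y) =
      Q ^+ 2 * ((x - Q)^-1 - (S - Q)^-1).
    by rewrite /y; field; rewrite !gt_eqF.
  rewrite mulr_ge0 ?sqr_ge0 // subr_ge0 lef_pV2 ?posrE //; lra.
have yu : 4 * (x ^+ 2 / (x - Q)) <= y * u ^+ 2.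
  by rewrite mulrA ler_pdivrMr // mulrAC.
have yu2 : 4 * t ^+ 3 < y * (u + 2) ^+ 2.
  have : 0 < y * u by rewrite mulr_gt0.
  by rewrite sqrrD; lra.
have u2 : 0 <= u + 2 by lra.
have am := cubic_amgm (ltW y0) u2.
rewrite -subr_gt0 (_ : _ - _ = (y + (u + 2)) - 3 * t); last by rewrite /y /u; ring.
rewrite subr_gt0 ltNge; apply/negP => dt.
have d3 : (y + (u + 2)) ^+ 3 <= (3 * t) ^+ 3 by rewrite lerXn2r ?nnegrE //; lra.
by rewrite exprMn in d3; lra.
Qed.

End Arithmetic.

(** Applied with [b = r] or [b = s] and [D = s^2 - r^2], this removes the
    fractional exponents, since the bounds are obtained by comparing cubes. *)
Lemma powR_cube (R : realType) (b D : R) : 0 <= b -> 0 < D ->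
  (b `^ (4 / 3) * D `^ (- (1 / 3))) ^+ 3 * D = (b ^+ 2) ^+ 2.
Proof.
move=> b0 D0.
have cube y e : 0 <= y -> (y `^ e) ^+ 3 = y `^ (e * 3%:R) :> R.
  by move=> y0; rewrite powRrM powR_mulrn ?powR_ge0.
rewrite exprMn !cube ?(ltW D0) //.
have -> : 4 / 3 * 3%:R = 4%:R :> R by field.
have -> : - (1 / 3) * 3%:R = - 1 :> R by field.
by rewrite powR_inv1 ?ltW // powR_mulrn // divfK ?gt_eqF // -exprM.
Qed.

Theorem theorem6 (R : realType) (alpha : R) (L : nat -> {poly R}) (k : nat)
    (xm xM : R) :
  -1 < alpha ->
  laguerre_polynomials alpha L ->
  (1 <= k)%N ->
  least_zero (L k) xm ->
  largest_zero (L k) xM ->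
  let r := Num.sqrt (k%:R + alpha + 1) - Num.sqrt k%:R in
  let s := Num.sqrt (k%:R + alpha + 1) + Num.sqrt k%:R in
  xm > r ^+ 2 + 3 * r `^ (4 / 3) * (s ^+ 2 - r ^+ 2) `^ (- (1 / 3)) /\
  xM < s ^+ 2 - 3 * s `^ (4 / 3) * (s ^+ 2 - r ^+ 2) `^ (- (1 / 3)) + 2.
Proof.
move=> a1 LL k1 [rm minm] [rM maxM] r s.
have sf : size (L k) = k.+1 by case: LL.
have orth := laguerre_polynomials_orthogonal a1 LL (k := k).
have ode := laguerre_orthogonal_equation a1 sf orth.
have rr := orthogonal_real_rooted a1 sf orth.
have k0 : 0 < k%:R :> R by rewrite ltr0n.
have K2 : Num.sqrt (k%:R + alpha + 1) ^+ 2 = k%:R + alpha + 1 by rewrite sqr_sqrtr //; lra.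
have q2 : Num.sqrt k%:R ^+ 2 = k%:R :> R by rewrite sqr_sqrtr // ltW.
have q0 : 0 < Num.sqrt k%:R :> R by rewrite sqrtr_gt0.
have qK : Num.sqrt k%:R < Num.sqrt (k%:R + alpha + 1) by rewrite ltr_sqrt; lra.
have r0 : 0 <= r by rewrite /r; lra.
have s0 : 0 <= s by rewrite /s; lra.
have rs : r ^+ 2 < s ^+ 2 by rewrite ltrXn2r ?nnegrE // /r /s; lra.
have A0 : 0 < alpha + 1 by lra.
have bandE x : 4 * k%:R * x - (x - (alpha + 1)) ^+ 2 = (s ^+ 2 - x) * (x - r ^+ 2).
  have -> : alpha + 1 = s * r by rewrite /s /r mulrC -subr_sqr K2 q2; ring.
  by rewrite -q2 /s /r; ring.
have crit z h x : L k = ('X - z%:P) * h -> 0 < x -> x != z ->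
    ~~ root h x -> 2 * x * (L k)^`().[x] = (x - (alpha + 1)) * (L k).[x] ->
    4 * x ^+ 2 <= (s ^+ 2 - x) * (x - r ^+ 2) * (x - z) ^+ 2.
  move=> fE x0 xz hx cx; rewrite -bandE.
  apply: (critical_point_bound fE ode) => //.
    by apply: real_rooted_dvd rr; rewrite fE dvdp_mulIr.
  by rewrite fE hornerM mulf_neq0 // hornerXsubC subr_eq0.
split.
- have /factor_theorem[h] := rm; rewrite mulrC => fE.
  have z0 := orthogonal_root_gt0 a1 sf orth rm.
  have hz := orthogonal_root_simple a1 sf orth fE.
  have hmin y : root h y -> xm <= y by move=> hy; apply: minm; rewrite fE rootM hy orbT.
  have [x [x0 xz cx]] := critical_point_below A0 fE z0 hz hmin.
  rewrite -mulrA; apply: (@lower_bound_of_critical _ (s ^+ 2) _ _ x) => //.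
  + exact: sqr_ge0.
  + by rewrite mulr_ge0 ?powR_ge0.
  + by rewrite powR_cube // subr_gt0.
  + apply: (crit _ h) => //; first by rewrite lt_eqF.
    by apply/negP => /hmin; rewrite leNgt xz.
- have /factor_theorem[h] := rM; rewrite mulrC => fE.
  have z0 := orthogonal_root_gt0 a1 sf orth rM.
  have hz := orthogonal_root_simple a1 sf orth fE.
  have hmax y : root h y -> y <= xM by move=> hy; apply: maxM; rewrite fE rootM hy orbT.
  have [x [zx cx]] := critical_point_above (alpha + 1) fE z0 hz hmax.
  have x0 : 0 < x by exact: lt_trans zx.
  rewrite -mulrA; apply: (@upper_bound_of_critical _ _ (r ^+ 2) _ x) => //.
  + exact: sqr_ge0.
  + by rewrite mulr_ge0 ?powR_ge0.
  + by rewrite powR_cube // subr_gt0.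
  + apply: (crit _ h) => //; first by rewrite gt_eqF.
    by apply/negP => /hmax; rewrite leNgt zx.
Qed.
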